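(* For every environment $\Gamma=(c,\mu)$ (as described in the context), $$\mathbf{\Pi}(\Gamma)=\left\{(\pi_b,\pi_s)\in\mathbb{R}^2:\ \pi_b\ge 0,\ \ \pi_s\ge \underline{\pi}_s(\Gamma),\ \ \pi_b+\pi_s\le S(\Gamma)\right\}.$$
   Context: Environment: $V\subset\mathbb{R}$ is compact with $\underline v=\min V<\max V=\overline v$; $\mu$ is a probability measure on $\mathbb{R}$ with support $V$; $c:V\to\mathbb{R}$ is continuous with $v-c(v)\ge 0$ for all $v\in V$ and $\mathbb{E}_\mu[v-c(v)]>0$. Write $\Gamma=(c,\mu)$; all expectations are under $\mu$. Let $S(\Gamma)=\mathbb{E}[v-c(v)]$ and $\underline{\pi}_s(\Gamma)=\max\{\underline v-\mathbb{E}[c(v)],0\}$. An information structure $\tau$ consists of complete separable metric spaces $T_s,T_b$ (with Borel $\sigma$-algebras) and a probability distribution $P$ on $T_s\times T_b\times V$ whose marginal on $V$ is $\mu$. Game $(\Gamma,\tau)$: $(t_s,t_b,v)\sim P$ is drawn; Seller privately observes $t_s$ and posts a price $p\in\mathbb{R}$; Buyer privately observes $t_b$, sees $p$, and accepts or rejects. If Buyer accepts, payoffs are $v-p$ (Buyer) and $p-c(v)$ (Seller); otherwise both get $0$. Seller's strategy is a distributional strategy $\sigma$: a joint distribution on $\mathbb{R}\times T_s$ whose $T_s$-marginal equals the marginal of $P$ on $T_s$, with conditional $\sigma(\cdot|t_s)$. Buyer's strategy is a measurable $\alpha:\mathbb{R}\times T_b\to[0,1]$ (probability of accepting). Buyer's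 beliefs are $\nu(\cdot|p,t_b)\in\Delta(V)$. Ex ante payoffs are $\pi_b=\int (v-p)\alpha(p,t_b)\sigma(dp|t_s)P(dt_s,dt_b,dv)$ and $\pi_s=\int (p-c(v))\alpha(p,t_b)\sigma(dp|t_s)P(dt_s,dt_b,dv)$. A weak perfect Bayesian equilibrium (wPBE) is $(\sigma,\alpha,\nu)$ such that: (1) for every $(p,t_b)$, $\alpha(p,t_b)=1$ if $\mathbb{E}_{\nu(\cdot|p,t_b)}[v]>p$ and $\alpha(p,t_b)=0$ if $\mathbb{E}_{\nu(\cdot|p,t_b)}[v]<p$; (2) $\sigma$ maximizes Seller's ex ante payoff given $\alpha$ over all distributional strategies; (3) for every measurable $D\subseteq\mathbb{R}\times T_s\times T_b\times V$, $\int_D\nu(dv|p,t_b)\sigma(dp|t_s)P(dt_s,dt_b,V)=\int_D\sigma(dp|t_s)P(dt_s,dt_b,dv)$. $\Pi(\Gamma,\tau)$ is the set of payoff pairs $(\pi_b,\pi_s)$ of wPBE of $(\Gamma,\tau)$, and $\mathbf{\Pi}(\Gamma)=\bigcup_\tau\Pi(\Gamma,\tau)$ over all information structures. *)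

(* Defs.v *)
From HB Require Import structures.
From mathcomp Require Import all_boot all_order all_algebra.
From mathcomp Require Import all_classical all_reals all_analysis.
Set Implicit Arguments. Unset Strict Implicit. Unset Printing Implicit Defensive.
Import Order.TTheory GRing.Theory Num.Theory.
Import numFieldNormedType.Exports.
Local Open Scope classical_set_scope.
Local Open Scope ring_scope.

(** Support of a measure on R: points all of whose open balls have
    positive measure (= smallest closed set of full measure). *)
Definition msupport (R : realType) (mu : {measure set R -> \bar R}) : set R :=
  [set x | forall e : R, 0 < e -> (0 < mu (ball x e))%E].

Definition metric_open (R : realType) (T : Type) (dist : T -> T -> R) (A : set T) :=
  forall x, A x -> exists2 e : R, 0 < e & [set y | dist x y < e] `<=` A.

Definition polish_borel (R : realType) (d : measure_display) (T : measurableType d) :=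
  exists dist : T -> T -> R,
    [/\ [/\ (forall x y, 0 <= dist x y),
        (forall x y, dist x y = 0 <-> x = y),
        (forall x y, dist x y = dist y x) &
        (forall x y z, dist x z <= dist x y + dist y z)],
        (forall u : nat -> T,
            (forall e : R, 0 < e -> exists N, forall m n, (N <= m)%N -> (N <= n)%N ->
               dist (u m) (u n) < e) ->
            exists l, forall e : R, 0 < e -> exists N, forall n, (N <= n)%N -> dist (u n) l < e),
        (exists s : nat -> T, forall x (e : R), 0 < e -> exists n, dist x (s n) < e) &
        (@measurable d T = <<s metric_open dist >>)].

Section Game.
Context (R : realType) (dS dB : measure_display)
  (TS : measurableType dS) (TB : measurableType dB).

Definition buyer_payoff (P : probability ((TS * TB) * R)%type R)
  (sigma : R.-pker TS ~> R) (alpha : R * TB -> R) : \bar R :=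
  (\int[P]_x \int[sigma x.1.1]_p ((x.2 - p) * alpha (p, x.1.2))%:E)%E.

Definition seller_payoff (c : R -> R) (P : probability ((TS * TB) * R)%type R)
  (sigma : R.-pker TS ~> R) (alpha : R * TB -> R) : \bar R :=
  (\int[P]_x \int[sigma x.1.1]_p ((p - c x.2) * alpha (p, x.1.2))%:E)%E.

(** Weak perfect Bayesian equilibrium (sigma, alpha, nu) of the game (Gamma, tau),
    tau = (TS, TB, P). Seller's (distributional) strategy is represented by its
    conditional sigma(.|t_s), a probability kernel; Buyer's beliefs
    nu(.|p,t_b) form a probability kernel concentrated on V. *)
Definition wPBE (V : set R) (c : R -> R) (P : probability ((TS * TB) * R)%type R)
  (sigma : R.-pker TS ~> R) (alpha : R * TB -> R) (nu : R.-pker (R * TB)%type ~> R) :=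
  [/\ [/\ measurable_fun setT alpha,
      (forall q, 0 <= alpha q <= 1) &
      (forall q, nu q V = 1%E)],
      (forall p tb, (p%:E < \int[nu (p, tb)]_v v%:E)%E -> alpha (p, tb) = 1),
      (forall p tb, (\int[nu (p, tb)]_v v%:E < p%:E)%E -> alpha (p, tb) = 0),
      (forall sigma' : R.-pker TS ~> R,
          (seller_payoff c P sigma' alpha <= seller_payoff c P sigma alpha)%E) &
      (forall D : set (R * ((TS * TB) * R)),
          measurable D ->
          (\int[P]_x \int[sigma x.1.1]_p \int[nu (p, x.1.2)]_w (\1_D (p, (x.1, w)) : R)%:E)%E
          = (\int[P]_x \int[sigma x.1.1]_p (\1_D (p, x) : R)%:E)%E)].

End Game.

(** Pi(Gamma, tau): equilibrium payoff pairs for the information structure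
    tau = (TS, TB, P); P must have V-marginal mu. *)
Definition eq_payoffs (R : realType) (V : set R) (c : R -> R)
  (mu : probability R R) (dS dB : measure_display)
  (TS : measurableType dS) (TB : measurableType dB)
  (P : probability ((TS * TB) * R)%type R) : set (R * R) :=
  [set pi | exists sigma alpha nu,
      wPBE V c P sigma alpha nu /\
      buyer_payoff P sigma alpha = pi.1%:E /\
      seller_payoff c P sigma alpha = pi.2%:E].

Definition info_structure (R : realType) (mu : probability R R)
  (dS dB : measure_display) (TS : measurableType dS) (TB : measurableType dB)
  (P : probability ((TS * TB) * R)%type R) :=
  [/\ polish_borel R TS, polish_borel R TB &
      forall A : set R, measurable A -> P (setT `*` A) = mu A].

Definition all_eq_payoffs (R : realType) (V : set R) (c : R -> R)
  (mu : probability R R) : set (R * R) :=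
  [set pi | exists (dS dB : measure_display) (TS : measurableType dS)
      (TB : measurableType dB) (P : probability ((TS * TB) * R)%type R),
      info_structure mu P /\ eq_payoffs V c mu P pi].

Definition surplus (R : realType) (V : set R) (c : R -> R) (mu : probability R R) : R :=
  fine (\int[mu]_(v in V) (v - c v)%:E)%E.

Definition seller_lb (R : realType) (V : set R) (c : R -> R) (mu : probability R R)
  (vlo : R) : R :=
  Num.max (vlo - fine (\int[mu]_(v in V) (c v)%:E)%E) 0.

(* Main.v *)
Require Import Defs.
From HB Require Import structures.
From mathcomp Require Import all_boot all_order all_algebra.
From mathcomp Require Import all_classical all_reals all_analysis.
From mathcomp Require Import measurable_realfun.
From mathcomp Require Import ring lra.
Import Order.TTheory GRing.Theory Num.Theory.
Import numFieldNormedType.Exports.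
Local Open Scope classical_set_scope.
Local Open Scope ring_scope.
Set Implicit Arguments.
Unset Strict Implicit.

(** Necessity. By consistency of the beliefs, Buyer's payoff is the integral of
    (E_nu[v] - p) alpha, which sequential rationality makes nonnegative. Every
    price below [vlo] is accepted and every price above [vhi] is rejected, so
    constant prices guarantee Seller vlo - E[c] and 0. Conditionally on
    (ts, tb, v), the payoffs add up to (v - c) alpha <= v - c.

    Sufficiency. An uninformative structure is enough: let both type spaces be
    [unit]. To reach Seller's payoff s, Seller mixes between the price s + E[c],
    which is accepted, and the price E[v], at which Buyer is indifferent and
    accepts with probability s / S. Both prices earn s for Seller; they leave
    Buyer with S - s and 0 respectively, so the mixing weight sets Buyer's payoff
    to any value in [0, S - s]. Off path, Buyer believes that v = vlo and accepts
    exactly the prices p <= vlo, which earn Seller at most vlo - E[c] <= s. *)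

(** * Comparison of integrals up to a null set *)

Section IntegralTools.
Context (d : measure_display) (T : measurableType d) (R : realType).
Implicit Type mu : {measure set T -> \bar R}.

Import HBNNSimple.

(** The integral of a nonnegative function is the supremum over the simple functions below it. A
    simple function below [f], cut to 0 on [N], keeps its integral and lies below [g]. *)
Lemma ge0_le_integral_off_null mu (N : set T) (f g : T -> \bar R) :
  measurable N -> mu N = 0%E ->
  (forall x, 0 <= f x)%E -> (forall x, 0 <= g x)%E ->
  (forall x, ~ N x -> f x <= g x)%E ->
  (\int[mu]_x f x <= \int[mu]_x g x)%E.
Proof.
move=> mN N0 f0 g0 fg; rewrite ge0_integralTE// ge0_integralTE//.
apply: ge_ereal_sup => _ /= [h hf <-].
have mCN : measurable (~` N) by exact: measurableC.
pose h' := proj_nnsfun h mCN.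
have -> : sintegral mu h = sintegral mu h'.
  rewrite -!integralT_nnsfun; apply: ge0_ae_eq_integral => //.
  - exact/measurable_EFinP.
  - exact/measurable_EFinP.
  - by move=> x _; rewrite lee_fin.
  - by move=> x _; rewrite lee_fin.
  exists N; split => // x /= /not_implyP[_ hx]; apply: contrapT => Nx.
  apply: hx.
  by rewrite /h' /= mindicE mem_set//= mulr1.
apply: ereal_sup_ubound; exists h' => // x.
rewrite /h' /= mindicE; case: (boolP (x \in _)) => /= xN.
  by rewrite mulr1; apply: le_trans (hf x) (fg x _); move: xN; rewrite inE.
by rewrite mulr0 g0.
Qed.

(* [f] and [g] are not assumed measurable, as [c] is arbitrary outside [V]. *)
Lemma le_integral_off_null mu (N : set T) (f g : T -> \bar R) :
  measurable N -> mu N = 0%E -> (forall x, ~ N x -> f x <= g x)%E ->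
  (\int[mu]_x f x <= \int[mu]_x g x)%E.
Proof.
move=> mN N0 fg; rewrite integralE [leRHS]integralE; apply: leeB.
  apply: (ge0_le_integral_off_null mN N0) => // x Nx.
  by rewrite !funeposE ge_max le_max fg//= le_max lexx orbT.
apply: (ge0_le_integral_off_null mN N0) => // x Nx.
by rewrite !funenegE ge_max le_max leeN2 fg//= le_max lexx orbT.
Qed.

Lemma le_integralT mu (f g : T -> \bar R) : (forall x, f x <= g x)%E ->
  (\int[mu]_x f x <= \int[mu]_x g x)%E.
Proof. by move=> fg; apply: (@le_integral_off_null _ set0) => //. Qed.

Lemma eq_integral_off_null mu (N : set T) (f g : T -> \bar R) :
  measurable N -> mu N = 0%E -> (forall x, ~ N x -> f x = g x)%E ->
  (\int[mu]_x f x = \int[mu]_x g x)%E.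
Proof.
move=> mN N0 fg; apply/le_anti/andP.
by split; apply: (le_integral_off_null mN N0) => x Nx; rewrite fg.
Qed.

(** The integral is the difference of those of the positive and negative parts, and such a
    difference is finite only if both are. This turns a finite payoff into an integrable payoff
    function. *)
Lemma fin_num_integral_integrable mu (f : T -> \bar R) :
  measurable_fun setT f -> (\int[mu]_x f x)%E \is a fin_num ->
  mu.-integrable setT f.
Proof.
move=> mf; rewrite integralE fin_numB => /andP[fp fn].
apply/integrableP; split => //.
apply: (@le_lt_trans _ _ (\int[mu]_x (f^\+ x + f^\- x))%E).
  apply: le_integralT => x; rewrite funeposE funenegE.
  have [fx|fx] := leP 0%E (f x).
    by rewrite gee0_abs // leeDl // le_max lexx orbT.
  by rewrite lte0_abs // add0e le_max lexx.
rewrite ge0_integralD//; last 2 first.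
- exact: measurable_funepos.
- exact: measurable_funeneg.
by rewrite lte_add_pinfty // ltey_eq ?fp ?fn.
Qed.

Lemma bounded_integrable mu (f : T -> R) (M : R) : (mu setT < +oo)%E ->
  measurable_fun setT f -> (forall x, `|f x| <= M) ->
  mu.-integrable setT (EFin \o f).
Proof.
move=> fmu mf fM; apply: measurable_bounded_integrable => //.
exists M; split; first exact: num_real.
by move=> x Mx y _ /=; exact: le_trans (fM y) (ltW Mx).
Qed.

Lemma integral_prob_cst mu (k : R) : mu setT = 1%E ->
  (\int[mu]_x k%:E = k%:E)%E.
Proof. by move=> mu1; rewrite integral_cst// mu1 mule1. Qed.

Lemma le_integral_cst mu (N : set T) (k : R) (f : T -> \bar R) :
  mu setT = 1%E -> measurable N -> mu N = 0%E ->
  (forall x, ~ N x -> k%:E <= f x)%E -> (k%:E <= \int[mu]_x f x)%E.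
Proof.
by move=> mu1 mN N0 kf; rewrite -(integral_prob_cst k mu1);
  exact: le_integral_off_null N0 kf.
Qed.

Lemma ge_integral_cst mu (N : set T) (k : R) (f : T -> \bar R) :
  mu setT = 1%E -> measurable N -> mu N = 0%E ->
  (forall x, ~ N x -> f x <= k%:E)%E -> (\int[mu]_x f x <= k%:E)%E.
Proof.
by move=> mu1 mN N0 kf; rewrite -(integral_prob_cst k mu1);
  exact: le_integral_off_null N0 kf.
Qed.

End IntegralTools.

(** * Kernels that read part of the state, and constant kernels *)

Section PullbackKernel.
Context (dX dY dZ : measure_display) (X : measurableType dX)
  (Y : measurableType dY) (Z : measurableType dZ) (R : realType)
  (k : R.-pker Y ~> Z) (f : X -> Y).

(** A strategy or a belief depends on part of the state only; pulled back along a projection it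
    becomes a kernel on the whole state, ready for composition. The measurability proof is an
    argument so that the kernel instance can be attached to the term. *)
Definition pullback_kernel of measurable_fun setT f :
  X -> {measure set Z -> \bar R} := fun x => k (f x).

Hypothesis mf : measurable_fun setT f.

Let measurable_pullback U : measurable U ->
  measurable_fun setT (pullback_kernel mf ^~ U).
Proof. by move=> mU; exact: measurableT_comp (measurable_kernel k U mU) mf. Qed.

HB.instance Definition _ :=
  isKernel.Build _ _ _ _ _ (pullback_kernel mf) measurable_pullback.

Let pullback_prob x : pullback_kernel mf x setT = 1%E.
Proof. exact: prob_kernel. Qed.

HB.instance Definition _ := Kernel_isProbability.Build _ _ _ _ _
  (pullback_kernel mf) pullback_prob.

End PullbackKernel.

Section ConstantKernel.
Context (dX dY : measure_display) (X : measurableType dX)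
  (Y : measurableType dY) (R : realType) (P : probability Y R).

Definition cst_kernel : X -> {measure set Y -> \bar R} := fun=> P.

Let measurable_cst_kernel U : measurable U ->
  measurable_fun setT (cst_kernel ^~ U).
Proof. by move=> mU; exact: measurable_cst. Qed.

HB.instance Definition _ :=
  isKernel.Build _ _ _ _ _ cst_kernel measurable_cst_kernel.

Let cst_kernel_prob x : cst_kernel x setT = 1%E.
Proof. exact: probability_setT. Qed.

HB.instance Definition _ := Kernel_isProbability.Build _ _ _ _ _
  cst_kernel cst_kernel_prob.

End ConstantKernel.
Arguments cst_kernel {dX dY} X {Y R} P.

(** A Lindelöf argument: each point outside the support has a null ball, hence lies in a null ball
    with rational centre and radius, and there are countably many of these. *)
Lemma msupport_measure0 (R : realType) (mu : probability R R) :
  closed (msupport mu) -> mu (~` msupport mu) = 0%E.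
Proof.
move=> cV; have mV : measurable (~` msupport mu).
  by apply: measurableC; exact: closed_measurable.
pose B (q : rat * rat) : set R :=
  if mu (ball (ratr q.1 : R) (ratr q.2)) == 0%E
  then ball (ratr q.1 : R) (ratr q.2) else set0.
have mB q : measurable (B q).
  by rewrite /B; case: ifP => // _; exact: measurable_ball.
have B0 q : mu (B q) = 0%E
  by rewrite /B; case: ifPn => [/eqP//|_]; exact: measure0.
have sub : ~` msupport mu `<=` \bigcup_(q in setT) B q.
  move=> x /existsNP[e /not_implyP[e0 /negP]]; rewrite -leNgt => xe.
  (* A radius between e/4 and e/2 and a centre within e/4 of [x] put [x] inside the rational ball
     and keep that ball inside [ball x e]. *)
  have [r /andP[er re]] : exists r : rat, e / 4 < ratr r < e / 2.
    have /rat_in_itvoo [r] : e / 4 < e / 2 by lra.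
    by rewrite in_itv/=; exists r.
  have [q /andP[q1 q2]] : exists q : rat, x - e / 4 < ratr q < x + e / 4.
    have /rat_in_itvoo [q] : x - e / 4 < x + e / 4 by lra.
    by rewrite in_itv/=; exists q.
  exists (q, r) => //; rewrite /B /=; case: ifPn => [_|].
    by rewrite /ball/= ltr_norml; apply/andP; split; lra.
  move/negP; case; rewrite eq_le measure_ge0 andbT.
  apply: le_trans xe; apply: le_measure; rewrite ?inE//;
    try exact: measurable_ball.
  move=> y; rewrite /ball/= !ltr_norml => /andP[y1 y2].
  by apply/andP; split; lra.
(* Only surjectivity of the enumeration matters, so the default pair for invalid codes is
   harmless. *)
have [g gK] : exists g : nat -> rat * rat, forall q, exists n, g n = q.
  exists (fun n => odflt (0, 0) (unpickle n)) => q.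
  by exists (pickle q); rewrite pickleK.
apply: measure_negligible => //.
apply: (@negligibleS _ _ _ mu (\bigcup_n B (g n))).
  by move=> x /sub[q _ Bq]; have [n gn] := gK q; exists n; rewrite ?gn.
by apply: negligible_bigcup => n; apply/negligibleP; [exact: mB | exact: B0].
Qed.

(** * Consistency of beliefs, from events to nonnegative functions *)

Section Consistency.
Context (R : realType) (dS dB : measure_display)
  (TS : measurableType dS) (TB : measurableType dB).
Local Notation X := ((TS * TB) * R)%type.
Context (P : probability X R) (sigma : R.-pker TS ~> R)
  (nu : R.-pker (R * TB)%type ~> R).

Let seller_type (u : unit * X) : TS := u.2.1.1.
Let buyer_info (u : (unit * X) * R) : R * TB := (u.2, u.1.2.1.2).
Let actual (u : (unit * X) * R) : R * X := (u.2, u.1.2).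
Let believed (u : ((unit * X) * R) * R) : R * X := (u.1.2, (u.1.1.2.1, u.2)).

Let measurable_seller_type : measurable_fun setT seller_type.
Proof.
apply: measurableT_comp => //; apply: measurableT_comp => //.
Qed.

Let measurable_buyer_info : measurable_fun setT buyer_info.
Proof.
apply: measurable_fun_pair => //=.
by do 3 (apply: measurableT_comp => //).
Qed.

Let measurable_actual : measurable_fun setT actual.
Proof. by apply: measurable_fun_pair => //=; apply: measurableT_comp. Qed.

Let measurable_believed : measurable_fun setT believed.
Proof.
apply: measurable_fun_pair => /=; first exact: measurableT_comp.
apply: measurable_fun_pair => //=.
by do 3 (apply: measurableT_comp => //).
Qed.

(** Joint law of the price, the types and the true value. Composing kernels from [unit] turns the
    iterated integral into an integral against one measure. *)
Let law_actual : unit -> {measure set (R * X)%type -> \bar R} :=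
  mkcomp (cst_kernel unit P)
    (mkcomp (pullback_kernel sigma measurable_seller_type)
      (kdirac measurable_actual)).

(** The same law with the value redrawn from Buyer's belief after the price is seen. *)
Let law_believed : unit -> {measure set (R * X)%type -> \bar R} :=
  mkcomp (cst_kernel unit P)
    (mkcomp (pullback_kernel sigma measurable_seller_type)
      (mkcomp (pullback_kernel nu measurable_buyer_info)
        (kdirac measurable_believed))).

Let integral_law_actual (f : R * X -> \bar R) : measurable_fun setT f ->
  (forall z, 0 <= f z)%E ->
  (\int[law_actual tt]_z f z = \int[P]_x \int[sigma x.1.1]_p f (p, x))%E.
Proof.
move=> mf f0; rewrite integral_kcomp//; apply: eq_integral => x _.
rewrite integral_kcomp//; apply: eq_integral => p _.
by rewrite integral_dirac// diracT mul1e.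
Qed.

Let integral_law_believed (f : R * X -> \bar R) : measurable_fun setT f ->
  (forall z, 0 <= f z)%E ->
  (\int[law_believed tt]_z f z =
   \int[P]_x \int[sigma x.1.1]_p \int[nu (p, x.1.2)]_w f (p, (x.1, w)))%E.
Proof.
move=> mf f0; rewrite integral_kcomp//; apply: eq_integral => x _.
rewrite integral_kcomp//; apply: eq_integral => p _.
rewrite integral_kcomp//; apply: eq_integral => w _.
by rewrite integral_dirac// diracT mul1e.
Qed.

(** The hypothesis says that [law_actual] and [law_believed] agree on measurable sets; they are then
    the same measure and integrate [g] alike. *)
Lemma integral_consistent (g : R * X -> \bar R) :
  (forall D : set (R * X), measurable D ->
    (\int[P]_x \int[sigma x.1.1]_p \int[nu (p, x.1.2)]_w
        (\1_D (p, (x.1, w)) : R)%:E)%E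
    = (\int[P]_x \int[sigma x.1.1]_p (\1_D (p, x) : R)%:E)%E) ->
  measurable_fun setT g -> (forall z, 0 <= g z)%E ->
  (\int[P]_x \int[sigma x.1.1]_p \int[nu (p, x.1.2)]_w g (p, (x.1, w)))%E
  = (\int[P]_x \int[sigma x.1.1]_p g (p, x))%E.
Proof.
move=> consistent.

move=> mg g0; apply: etrans (integral_law_actual mg g0).
apply: etrans (esym (integral_law_believed mg g0)) _.
apply: eq_measure_integral => D mD _.
have mD1 : measurable_fun setT (fun z => (\1_D z : R)%:E).
  exact/measurable_EFinP/measurable_indic.
have indicE (m : {measure set (R * X)%type -> \bar R}) :
    m D = (\int[m]_z (\1_D z : R)%:E)%E by rewrite integral_indic// setIT.
have D0 z : (0 <= (\1_D z : R)%:E)%E by rewrite lee_fin.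
apply: etrans (indicE _) _; apply: etrans (esym (indicE _)).
apply: etrans (integral_law_believed mD1 D0) _.
by apply: etrans (esym (integral_law_actual mD1 D0)); exact: consistent.
Qed.

End Consistency.

(** * Integrals of affine functions, along kernels, and of functions of the value *)

Lemma integral_affine d (T : measurableType d) (R : realType)
  (mu : {measure set T -> \bar R}) (f : T -> R) (a b : R) :
  mu setT = 1%E -> mu.-integrable setT (EFin \o f) ->
  (\int[mu]_x (a * f x + b)%:E = a%:E * \int[mu]_x (f x)%:E + b%:E)%E.
Proof.
move=> mu1 intf.
have intaf : mu.-integrable setT (EFin \o (fun x => a * f x)).
  by rewrite (_ : _ \o _ = fun x => (a%:E * (f x)%:E)%E)//; exact: integrableZl.
have intb : mu.-integrable setT (EFin \o cst b).
  by apply: (@bounded_integrable _ _ _ _ _ `|b|); rewrite ?mu1 ?ltry.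
transitivity
  (\int[mu]_x ((EFin \o (fun x => a * f x)%R) \+ (EFin \o cst b)) x)%E => //.
rewrite integralD_EFin//= integral_prob_cst//.
by under eq_integral do rewrite EFinM; rewrite integralZl.
Qed.

Lemma measurable_integral_pker dX dY (X : measurableType dX)
  (Y : measurableType dY) (R : realType) (k : R.-pker X ~> Y)
  (f : X * Y -> R) : measurable_fun setT f ->
  measurable_fun setT (fun x => \int[k x]_y (f (x, y))%:E)%E.
Proof.
move=> mf; have mEf : measurable_fun setT (EFin \o f) by exact/measurable_EFinP.
rewrite (_ : (fun x => _) =
    (fun x => (\int[k x]_y (EFin \o f)^\+ (x, y)) -
              (\int[k x]_y (EFin \o f)^\- (x, y)))%E); last first.
  apply/funext => x; rewrite integralE; congr (_ - _)%E.
    by apply: eq_integral => y _; rewrite !funeposE.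
  by apply: eq_integral => y _; rewrite !funenegE.
apply: emeasurable_funB; apply: measurable_fun_integral_finite_kernel => //.
- exact: measurable_funepos.
- exact: measurable_funeneg.
Qed.

Lemma probability_lty d (T : measurableType d) (R : realType)
  (P : probability T R) : (P setT < +oo)%E.
Proof. by rewrite probability_setT ltry. Qed.

Section Marginal.
Context (d : measure_display) (T : measurableType d) (R : realType)
  (P : probability (T * R)%type R) (mu : probability R R).
Hypothesis marginal : forall A : set R, measurable A -> P (setT `*` A) = mu A.

Lemma integral_marginal (g : R -> R) (M : R) :
  measurable_fun setT g -> (forall v, `|g v| <= M) ->
  (\int[P]_x (g x.2)%:E = \int[mu]_v (g v)%:E)%E.
Proof.
move=> mg gM.
have mg2 : measurable_fun setT (fun x : T * R => g x.2).
  exact: measurableT_comp.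
transitivity (\int[pushforward P (@snd T R)]_v (g v)%:E)%E.
  rewrite integral_pushforward//; first exact/measurable_EFinP.
  rewrite preimage_setT.
  exact: (@bounded_integrable _ _ _ _ (fun x => g x.2) M (probability_lty P)).
apply: eq_measure_integral => A mA _; apply: etrans (marginal mA).
by rewrite /= /pushforward; congr (P _); apply/seteqP; split => x //= -[].
Qed.

End Marginal.

(** * Mean value, mean cost and surplus *)

Section Environment.
Context (R : realType) (mu : probability R R) (V : set R) (c : R -> R)
  (vlo vhi K : R).
Hypotheses (mV : measurable V)
  (Vb : forall v, V v -> vlo <= v <= vhi)
  (mc : measurable_fun setT (c \_ V)) (cK : forall v, `|(c \_ V) v| <= K).

(** Extension by 0 outside [V] gives a function that is bounded and measurable on the whole line. *)
Definition mean_value : R := fine (\int[mu]_v ((id \_ V) v)%:E)%E.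
Definition mean_cost : R := fine (\int[mu]_(v in V) (c v)%:E)%E.

Lemma value_bound v : `|(id \_ V) v| <= `|vlo| + `|vhi|.
Proof.
rewrite patchE; case: ifPn => [|_]; last by rewrite normr0 addr_ge0.
rewrite inE => /Vb /andP[lo hi]; rewrite ler_norml.
have := ler_norm (- vlo); have := ler_norm vhi; rewrite normrN.
have := normr_ge0 vlo; have := normr_ge0 vhi.
by move=> *; apply/andP; split; lra.
Qed.

Lemma measurable_value : measurable_fun setT (id \_ V : R -> R).
Proof. by apply/(measurable_restrictT _ mV); exact: measurable_id. Qed.

Lemma integrable_value : mu.-integrable setT (EFin \o (id \_ V)).
Proof.
exact: (bounded_integrable (probability_lty _) measurable_value value_bound).
Qed.

Lemma integrable_cost : mu.-integrable setT (EFin \o (c \_ V)).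
Proof. exact: (bounded_integrable (probability_lty _) mc cK). Qed.

Lemma mean_valueE : (\int[mu]_v ((id \_ V) v)%:E = mean_value%:E)%E.
Proof.
by rewrite fineK//; apply: integrable_fin_num => //; exact: integrable_value.
Qed.

Lemma mean_costE : (\int[mu]_v ((c \_ V) v)%:E = mean_cost%:E)%E.
Proof.
have cVE : (\int[mu]_(v in V) (c v)%:E = \int[mu]_v ((c \_ V) v)%:E)%E.
  rewrite integral_mkcond; apply: eq_integral => v _.
  by rewrite !patchE; case: ifPn.
rewrite /mean_cost cVE fineK//; apply: integrable_fin_num => //.
exact: integrable_cost.
Qed.

Lemma integral_surplus :
  (\int[mu]_(v in V) (v - c v)%:E = (mean_value - mean_cost)%:E)%E.
Proof.
rewrite integral_mkcond EFinB -mean_valueE -mean_costE.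
rewrite -integralB_EFin//; [|exact: integrable_value|exact: integrable_cost].
by apply: eq_integral => v _; rewrite !patchE; case: ifPn => //; rewrite subee.
Qed.

Lemma surplusE : surplus V c mu = mean_value - mean_cost.
Proof. by rewrite /surplus integral_surplus. Qed.

End Environment.

Lemma integralB_ge0 d (T : measurableType d) (R : realType)
  (mu : {measure set T -> \bar R}) (f g : T -> \bar R) :
  mu.-integrable setT f -> mu.-integrable setT g ->
  (\int[mu]_x g x <= \int[mu]_x f x)%E -> (0 <= \int[mu]_x (f x - g x))%E.
Proof.
by move=> intf intg gf; rewrite integralB// sube_ge0// integrable_fin_num.
Qed.

(** * Necessity: bounds on the payoffs of an arbitrary equilibrium *)

Section Necessity.
Context (R : realType) (mu : probability R R) (V : set R) (c : R -> R)
  (vlo vhi K : R).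
Hypotheses (mV : measurable V) (V0 : mu (~` V) = 0%E)
  (Vb : forall v, V v -> vlo <= v <= vhi) (vlohi : vlo < vhi)
  (mc : measurable_fun setT (c \_ V)) (cK : forall v, `|(c \_ V) v| <= K)
  (cv : forall v, V v -> 0 <= v - c v).
Context (dS dB : measure_display)
  (TS : measurableType dS) (TB : measurableType dB).
Local Notation X := ((TS * TB) * R)%type.
Context (P : probability X R).
Hypothesis marginal : forall A : set R, measurable A -> P (setT `*` A) = mu A.
Context (sigma : R.-pker TS ~> R) (alpha : R * TB -> R)
  (nu : R.-pker (R * TB)%type ~> R).
Hypothesis eqm : wPBE V c P sigma alpha nu.

Let N : set X := setT `*` ~` V.

Let mN : measurable N.
Proof. by apply: measurableX => //; exact: measurableC. Qed.

Let N0 : P N = 0%E.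
Proof. by rewrite marginal//; exact: measurableC. Qed.

Let notN (x : X) : ~ N x -> V x.2.
Proof. by move=> Nx; apply: contrapT => Vx; apply: Nx. Qed.

Let P1 : P setT = 1%E. Proof. exact: probability_setT. Qed.

Let malpha : measurable_fun setT alpha. Proof. by case: eqm => -[]. Qed.

Let alpha_ge0 q : 0 <= alpha q.
Proof. by case: eqm => -[_ /(_ q)/andP[]]. Qed.

Let alpha_le1 q : alpha q <= 1.
Proof. by case: eqm => -[_ /(_ q)/andP[]]. Qed.

Let nu1 q : nu q setT = 1%E. Proof. exact: prob_kernel. Qed.

Let nu0 q : nu q (~` V) = 0%E.
Proof.
have nuV : nu q V = 1%E by case: eqm => -[_ _].
have : nu q (V `|` ~` V) = (nu q V + nu q (~` V))%E.
  by apply: measureU => //; [exact: measurableC | exact: setICr].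
rewrite setUv nu1 nuV; case: (nu q (~` V)) => [r| |]//= [] /eqP.
by rewrite -subr_eq0 opprD addrA subrr sub0r oppr_eq0 => /eqP ->.
Qed.

Let mCV : measurable (~` V). Proof. exact: measurableC. Qed.

Let notCV v : ~ (~` V) v -> V v. Proof. exact: contrapT. Qed.

Let belief_ge q : (vlo%:E <= \int[nu q]_v v%:E)%E.
Proof.
apply: (le_integral_cst (nu1 q) mCV (nu0 q)) => v /notCV /Vb /andP[].
by rewrite lee_fin.
Qed.

Let belief_le q : (\int[nu q]_v v%:E <= vhi%:E)%E.
Proof.
apply: (ge_integral_cst (nu1 q) mCV (nu0 q)) => v /notCV /Vb /andP[].
by rewrite lee_fin.
Qed.

(** The inequality is strict: at [vlo] itself Buyer may be indifferent and reject. *)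
Let accept p tb : p < vlo -> alpha (p, tb) = 1.
Proof.
move=> plo; case: eqm => _ + _ _ _; apply.
by apply: lt_le_trans (belief_ge _); rewrite lte_fin.
Qed.

Let reject p tb : vhi < p -> alpha (p, tb) = 0.
Proof.
move=> php; case: eqm => _ _ + _ _; apply.
by apply: le_lt_trans (belief_le _) _; rewrite lte_fin.
Qed.

(* Seller's price need not have a mean: truncating prices and values to
   [[vlo, vhi]] makes all the integrals finite. *)
Let clamp (r : R) : R := Num.min (Num.max r vlo) vhi.

Let clamp_ge r : vlo <= clamp r.
Proof. by rewrite /clamp le_min le_max lexx orbT ltW. Qed.

Let clamp_le r : clamp r <= vhi.
Proof. by rewrite /clamp ge_min lexx orbT. Qed.

Let clampV v : V v -> clamp v = v.
Proof. by move=> /Vb/andP[lo hi]; rewrite /clamp max_l// min_l. Qed.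

Let mclamp : measurable_fun setT clamp.
Proof. by apply: measurable_minr => //; exact: measurable_maxr. Qed.

(** Accepting with positive probability is rational only if the price is at most the expected value.
    That expectation is also at least [vlo], so it exceeds the larger of the two. *)
Let clamp_le_belief p tb :
  alpha (p, tb) != 0 -> ((clamp p)%:E <= \int[nu (p, tb)]_v v%:E)%E.
Proof.
move=> a0; have pE : (p%:E <= \int[nu (p, tb)]_v v%:E)%E.
  rewrite leNgt; apply/negP => Ep; case: eqm => _ _ /(_ _ _ Ep) a _ _.
  by rewrite a eqxx in a0.
apply: (@le_trans _ _ (Num.max p vlo)%:E).
  by rewrite lee_fin /clamp ge_min lexx.
by case: (leP p vlo).
Qed.

Let malpha2 : measurable_fun setT (fun z : R * X => alpha (z.1, z.2.1.2)).
Proof.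
apply: measurableT_comp => //; apply: measurable_fun_pair => //=.
by do 2 (apply: measurableT_comp => //).
Qed.

(** Measuring value and price from [vlo] makes both terms nonnegative and bounded, as
    [integral_consistent] and the later subtraction demand. *)
Let gain (z : R * X) : R := (clamp z.2.2 - vlo) * alpha (z.1, z.2.1.2).
Let price (z : R * X) : R := (clamp z.1 - vlo) * alpha (z.1, z.2.1.2).

Let mgain : measurable_fun setT gain.
Proof.
apply: measurable_funM => //; apply: measurable_funB => //.
by apply: measurableT_comp => //; exact: measurableT_comp.
Qed.

Let mprice : measurable_fun setT price.
Proof.
apply: measurable_funM => //; apply: measurable_funB => //.
exact: measurableT_comp.
Qed.

Let truncM r q : 0 <= (clamp r - vlo) * alpha q <= vhi - vlo.
Proof.
have := clamp_ge r; have := clamp_le r => hi lo.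
rewrite mulr_ge0 ?subr_ge0//=.
by rewrite (le_trans (ler_piMr _ (alpha_le1 q)))// ?subr_ge0// lerD2r.
Qed.

Let gain_ge0 z : 0 <= gain z.
Proof. by case/andP: (truncM z.2.2 (z.1, z.2.1.2)). Qed.

Let price_ge0 z : 0 <= price z.
Proof. by case/andP: (truncM z.1 (z.1, z.2.1.2)). Qed.

Let gain_le z : gain z <= vhi - vlo.
Proof. by case/andP: (truncM z.2.2 (z.1, z.2.1.2)). Qed.

Let price_le z : price z <= vhi - vlo.
Proof. by case/andP: (truncM z.1 (z.1, z.2.1.2)). Qed.

(** If Buyer rejects, the left side is 0. Otherwise [clamp_le_belief] is multiplied by [alpha]; the
    belief is concentrated on [V], where clamping changes nothing. *)
Let price_le_believed_gain p (x : X) :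
  ((price (p, x))%:E <= \int[nu (p, x.1.2)]_w (gain (p, (x.1, w)))%:E)%E.
Proof.
have [a0|a0] := eqVneq (alpha (p, x.1.2)) 0.
  rewrite /price /= a0 mulr0; apply: integral_ge0 => w _.
  by rewrite lee_fin.
have intcl : (nu (p, x.1.2)).-integrable setT (EFin \o clamp).
  apply: (@bounded_integrable _ _ _ _ _ (`|vlo| + `|vhi|)) => //.
    by rewrite [ltLHS]nu1 ltry.
  move=> r; have := clamp_ge r; have := clamp_le r.
  have := ler_norm (- vlo); have := ler_norm vhi; rewrite normrN.
  have := normr_ge0 vlo; have := normr_ge0 vhi.
  by move=> *; rewrite ler_norml; apply/andP; split; lra.
rewrite /gain /=.
have -> : (fun w => ((clamp w - vlo) * alpha (p, x.1.2))%:E) =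
    (fun w => (alpha (p, x.1.2) * clamp w + - (vlo * alpha (p, x.1.2)))%:E).
  by apply/funext => w; congr EFin; ring.
rewrite integral_affine//.
have clE : (\int[nu (p, x.1.2)]_w (clamp w)%:E = \int[nu (p, x.1.2)]_w w%:E)%E.
  by apply: (eq_integral_off_null mCV (nu0 _)) => w /notCV/clampV ->.
have := clamp_le_belief a0; rewrite -clE.
have /fineK <- : (\int[nu (p, x.1.2)]_w (clamp w)%:E)%E \is a fin_num.
  exact: integrable_fin_num.
rewrite -EFinM -EFinD !lee_fin => le; rewrite /price /=.
rewrite mulrBl lerD2r mulrC; exact: ler_wpM2l.
Qed.

Let measurable_interim (f : R * X -> R) : measurable_fun setT f ->
  measurable_fun setT (fun x : X => \int[sigma x.1.1]_p (f (p, x))%:E)%E.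
Proof.
have mst : measurable_fun setT (fun x : X => x.1.1) by exact: measurableT_comp.
move=> mf; apply: (@measurable_integral_pker _ _ _ _ _
  (pullback_kernel sigma mst) (fun z => f (z.2, z.1))).
by apply: measurableT_comp => //; exact: measurable_fun_pair.
Qed.

Lemma buyer_payoff_ge0 : (0 <= buyer_payoff P sigma alpha)%E.
Proof.
pose A (x : X) := (\int[sigma x.1.1]_p (gain (p, x))%:E)%E.
pose B (x : X) := (\int[sigma x.1.1]_p (price (p, x))%:E)%E.
have mA : measurable_fun setT A by exact: measurable_interim mgain.
have mB : measurable_fun setT B by exact: measurable_interim mprice.
have s1 (x : X) : sigma x.1.1 setT = 1%E by exact: prob_kernel.
have fin_bounded (g : X -> \bar R) : (forall x, 0 <= g x <= (vhi - vlo)%:E)%E ->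
    (\int[P]_x g x)%E \is a fin_num.
  move=> gb; rewrite ge0_fin_numE; last first.
    by apply: integral_ge0 => x _; case/andP: (gb x).
  apply: (@le_lt_trans _ _ (vhi - vlo)%:E); last exact: ltry.
  apply: (@ge_integral_cst _ _ _ _ set0) => // x _; by case/andP: (gb x).
have boundA x : (0 <= A x <= (vhi - vlo)%:E)%E.
  rewrite integral_ge0 => [|p _]; last by rewrite lee_fin.
  by apply: (@ge_integral_cst _ _ _ _ set0) => // p _; rewrite lee_fin.
have boundB x : (0 <= B x <= (vhi - vlo)%:E)%E.
  rewrite integral_ge0 => [|p _]; last by rewrite lee_fin.
  by apply: (@ge_integral_cst _ _ _ _ set0) => // p _; rewrite lee_fin.
have intA : P.-integrable setT A.
  by apply: fin_num_integral_integrable => //; exact: fin_bounded.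
have intB : P.-integrable setT B.
  by apply: fin_num_integral_integrable => //; exact: fin_bounded.
(* Consistency replaces the actual value by one drawn from the belief, after which rationality
   applies at each price. *)
have BA : (\int[P]_x B x <= \int[P]_x A x)%E.
  have mEgain : measurable_fun setT (EFin \o gain) by exact/measurable_EFinP.
  have gain0 z : (0 <= (EFin \o gain) z)%E by rewrite lee_fin.
  have consistent := let: And5 _ _ _ _ h := eqm in h.
  rewrite -[leRHS](integral_consistent consistent mEgain gain0).
  apply: le_integralT => x; apply: le_integralT => p.
  exact: price_le_believed_gain.
apply: le_trans (integralB_ge0 intA intB BA) _.
apply: (le_integral_off_null mN N0) => x /notN Vx.
have intx (f : R * X -> R) : measurable_fun setT f ->
    (forall z, 0 <= f z <= vhi - vlo) ->
    (sigma x.1.1).-integrable setT (EFin \o (fun p => f (p, x))).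
  move=> mf fb; apply: (@bounded_integrable _ _ _ _ _ (vhi - vlo)).
  - by rewrite [ltLHS]s1 ltry.
  - by apply: measurableT_comp => //; exact: measurable_fun_pair.
  - by move=> p; have /andP[f0 f1] := fb (p, x); rewrite ger0_norm.
have intgain := intx _ mgain
  (fun z => introT andP (conj (gain_ge0 z) (gain_le z))).
have intprice := intx _ mprice
  (fun z => introT andP (conj (price_ge0 z) (price_le z))).
rewrite -integralB_EFin//.
(* Undoing the truncation can only help Buyer: the value lies in [V] and is unchanged, prices above
   [vhi] are rejected, and clamping any other price can only raise it. *)
apply: le_integralT => p; rewrite -EFinB lee_fin /gain /price /= clampV//.
have [php|php] := ltP vhi p; first by rewrite reject// !mulr0 subrr.
rewrite -mulrBl ler_wpM2r// opprB addrA subrK lerB//.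
by rewrite /clamp le_min php le_max lexx.
Qed.

Let seller_payoff_ge_dev (p : R) :
  (\int[P]_x ((p - c x.2) * alpha (p, x.1.2))%:E
    <= seller_payoff c P sigma alpha)%E.
Proof.
have mp : measurable_fun setT (cst p : TS -> R) by exact: measurable_cst.
case: eqm => _ _ _ /(_ (kdirac mp)) dev _; apply: le_trans dev.
apply: le_integralT => x; rewrite integral_dirac//.
  by rewrite diracT mul1e.
apply/measurable_EFinP; apply: measurable_funM; first exact: measurable_funB.
by apply: measurableT_comp => //; exact: measurable_fun_pair.
Qed.

Let integral_cost : (\int[P]_x ((c \_ V) x.2)%:E = (mean_cost mu V c)%:E)%E.
Proof. by rewrite (integral_marginal marginal mc cK) (mean_costE mu mc cK). Qed.

Let integrable_cost2 : P.-integrable setT (EFin \o (fun x => (c \_ V) x.2)).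
Proof.
apply: (@bounded_integrable _ _ _ _ (fun x : X => (c \_ V) x.2) K) => //.
  exact: probability_lty.
exact: measurableT_comp.
Qed.

Lemma seller_payoff_ge_lb ps : seller_payoff c P sigma alpha = ps%:E ->
  seller_lb V c mu vlo <= ps.
Proof.
move=> psE; rewrite /seller_lb -/(mean_cost mu V c) ge_max; apply/andP; split.
- rewrite leNgt; apply/negP => psl.
  (* The midpoint of [vlo] and the price that would earn exactly [ps] if surely accepted: it is
     surely accepted and earns more than [ps]. *)
  pose p := (vlo + (ps + mean_cost mu V c)) / 2.
  have plo : p < vlo by rewrite /p; lra.
  have := seller_payoff_ge_dev p; rewrite psE.
  rewrite (eq_integral_off_null mN N0
    (g := fun x => (- 1 * (c \_ V) x.2 + p)%:E)); last first.
    move=> x /notN Vx; rewrite accept// patchE mem_set//; congr EFin; ring.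
  rewrite integral_affine// integral_cost -EFinM -EFinD lee_fin /p; lra.
(* A price above [vhi] is rejected by all types, so this deviation earns 0. *)
- have := seller_payoff_ge_dev (vhi + 1); rewrite psE.
  rewrite integral0_eq ?lee_fin// => x _.
  by rewrite reject ?mulr0// ltrDl.
Qed.

(** Seller's integrand involves [c] outside [V], so the two payoffs are not added directly. Instead
    Seller's payoff is bounded by the integral of [g - F], where [F] is Buyer's payoff given types
    and value: pointwise, (p - c) alpha <= (v - c) - (v - p) alpha. *)
Lemma total_payoff_le pb ps :
  buyer_payoff P sigma alpha = pb%:E ->
  seller_payoff c P sigma alpha = ps%:E ->
  pb + ps <= mean_value mu V - mean_cost mu V c.
Proof.
move=> pbE psE.
pose f (z : R * X) := (z.2.2 - z.1) * alpha (z.1, z.2.1.2).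
have mf : measurable_fun setT f.
  apply: measurable_funM => //; apply: measurable_funB => //.
  exact: measurableT_comp.
pose F (x : X) := (\int[sigma x.1.1]_p (f (p, x))%:E)%E.
have mF : measurable_fun setT F by exact: measurable_interim.
have FE : (\int[P]_x F x)%E = pb%:E by exact: pbE.
(* Finiteness of Buyer's payoff makes [F] integrable, hence finite outside a null set [N']; there
   the integrand over prices is integrable too. *)
have intF : P.-integrable setT F.
  by apply: fin_num_integral_integrable => //; rewrite FE.
have [N' [mN' N'0 finF]] := integrable_ae measurableT intF.
pose g v := (id \_ V) v - (c \_ V) v.
have mg : measurable_fun setT g.
  by apply: measurable_funB => //; exact: measurable_value.
have gM v : `|g v| <= `|vlo| + `|vhi| + K.
  by apply: le_trans (ler_normB _ _) _; rewrite lerD// (value_bound Vb).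
have intg : P.-integrable setT (EFin \o (fun x => g x.2)).
  apply: (@bounded_integrable _ _ _ _ (fun x : X => g x.2) _ (probability_lty P)).
    exact: measurableT_comp.
  by move=> x; exact: gM.
have gE : (\int[P]_x (g x.2)%:E =
    (mean_value mu V - mean_cost mu V c)%:E)%E.
  rewrite (integral_marginal marginal mg gM) EFinB.
  rewrite -(mean_valueE mu mV Vb) -(mean_costE mu mc cK) -integralB_EFin//.
    exact: (integrable_value mu mV Vb).
  exact: (integrable_cost mu mc cK).
rewrite addrC -lerBrDr -lee_fin EFinB -gE -pbE -psE.
apply: (@le_trans _ _ (\int[P]_x ((g x.2)%:E - F x))%E); last first.
  by rewrite integralB.
apply: (@le_integral_off_null _ _ _ _ (N `|` N')).
- exact: measurableU.
- by rewrite measureU0.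
move=> x /not_orP[/notN Vx N'x].
have Fx : F x \is a fin_num.
  by apply: contrapT => Fx; apply: N'x; apply: finF => /= /(_ I).
have mfx : measurable_fun setT (fun p => f (p, x)).
  by apply: measurableT_comp => //; exact: measurable_fun_pair.
have intf : (sigma x.1.1).-integrable setT (EFin \o (fun p => f (p, x))).
  by apply: fin_num_integral_integrable => //; exact/measurable_EFinP.
rewrite (_ : (_ - _)%E = (\int[sigma x.1.1]_p (- 1 * f (p, x) + g x.2)%:E)%E).
  apply: le_integralT => p; rewrite lee_fin /f /g /= !patchE mem_set//.
  have := cv Vx; have := alpha_le1 (p, x.1.2); nra.
by rewrite integral_affine ?prob_kernel// EFinN mulN1e addeC.
Qed.

End Necessity.

(** * The one-point type space *)

Lemma polish_borel_unit (R : realType) : polish_borel R unit.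
Proof.
exists (fun _ _ => 0); split => /=.
- by split => //; case=> -[].
- by move=> u _; exists tt => e e0; exists 0%N.
- by exists (fun=> tt) => _ e e0; exists 0%N.
(* On one point every set is open, with radius 1 as witness. *)
- apply/seteqP; split=> A // _; apply: sub_sigma_algebra => x Ax.
  by exists 1 => // -[] _; case: x Ax.
Qed.

(** * Seller's mixture of two prices *)

Section TwoPointLaw.
Context (R : realType) (l a b : R).
Hypothesis l01 : 0 <= l <= 1.

Let pick (t : bool) : R := if t then a else b.

Let measurable_pick : measurable_fun setT pick. Proof. by []. Qed.

Let pickM : {mfun bool >-> R} :=
  HB.pack pick (isMeasurableFun.Build _ _ _ _ _ measurable_pick).

(** An image of a Bernoulli law, so that [a] and [b] may coincide; they do when Seller takes the
    whole surplus. *)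
Definition two_point_law : probability R R :=
  distribution (bernoulli_prob l) pickM.

Lemma ge0_integral_two_point (f : R -> \bar R) :
  measurable_fun setT f -> (forall x, 0 <= f x)%E ->
  (\int[two_point_law]_x f x = l%:E * f a + (1 - l)%:E * f b)%E.
Proof.
move=> mf f0; rewrite ge0_integral_distribution// integral_bernoulli_prob//.
by move=> t; exact: f0.
Qed.

Lemma integral_two_point (f : R -> R) : measurable_fun setT f ->
  (\int[two_point_law]_x (f x)%:E = (l * f a + (1 - l) * f b)%:E)%E.
Proof.
move=> mf; have mEf : measurable_fun setT (EFin \o f) by exact/measurable_EFinP.
rewrite integralE ge0_integral_two_point//; last exact: measurable_funepos.
rewrite ge0_integral_two_point//; last exact: measurable_funeneg.
rewrite !funeposE !funenegE /= -!EFin_max -!EFinM -!EFinD.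
have posneg x : Num.max x 0 - Num.max (- x) 0 = x :> R.
  by case: (leP x 0) => ?; case: (leP (- x) 0) => ?; lra.
rewrite -[in RHS](posneg (f a)) -[in RHS](posneg (f b)).
by congr EFin; ring.
Qed.

End TwoPointLaw.

(** * Beliefs on and off the path *)

Section OffPathBelief.
Context (R : realType) (mu : probability R R) (d : measure_display)
  (T : measurableType d) (A : set T) (v0 : R).
(** [A] will hold the prices that Seller may play, where an uninformed Buyer keeps the prior.
    Elsewhere the belief is free, and the lowest value [v0 = vlo] deters deviations best. *)
Definition prior_or_dirac of measurable A :
  T -> {measure set R -> \bar R} := fun q => if q \in A then mu else \d_v0.

Hypothesis mA : measurable A.

Let measurable_prior_or_dirac U : measurable U ->
  measurable_fun setT (prior_or_dirac mA ^~ U).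
Proof.
move=> mU; have -> : prior_or_dirac mA ^~ U =
    (fun q => if q \in A then mu U else \d_v0 U).
  by apply/funext => q; rewrite /prior_or_dirac; case: ifP.
apply: measurable_fun_ifT => //; apply: (measurable_fun_bool true).
rewrite setTI (_ : _ @^-1` _ = A)//; apply/seteqP; split => x /=.
  by move/set_mem.
by move/mem_set.
Qed.

HB.instance Definition _ :=
  isKernel.Build _ _ _ _ _ (prior_or_dirac mA) measurable_prior_or_dirac.

Let prior_or_dirac_prob q : prior_or_dirac mA q setT = 1%E.
Proof. by rewrite /prior_or_dirac; case: ifP => _; exact: probability_setT. Qed.

HB.instance Definition _ := Kernel_isProbability.Build _ _ _ _ _
  (prior_or_dirac mA) prior_or_dirac_prob.

End OffPathBelief.

(** * Sufficiency: the two-price equilibrium *)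

Section Sufficiency.
Context (R : realType) (mu : probability R R) (V : set R) (c : R -> R)
  (vlo vhi K : R).
Hypotheses (mV : measurable V) (V0 : mu (~` V) = 0%E) (Vlo : V vlo)
  (Vb : forall v, V v -> vlo <= v <= vhi)
  (mc : measurable_fun setT (c \_ V)) (cK : forall v, `|(c \_ V) v| <= K).
Let Ev := mean_value mu V.
Let Ec := mean_cost mu V c.
Context (s l : R).
Hypotheses (s0 : 0 <= s) (slb : vlo - Ec <= s) (sub : s <= Ev - Ec)
  (S0 : 0 < Ev - Ec) (l01 : 0 <= l <= 1).
Local Notation X := ((unit * unit) * R)%type.

Let plow : R := s + Ec.

(** If [s] is the whole surplus, [plow] equals [Ev] and the first test decides; it then returns 1,
    in agreement with the second. *)
Let alpha (q : R * unit) : R :=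
  if q.1 == Ev then s / (Ev - Ec)
  else if q.1 == plow then 1 else if q.1 <= vlo then 1 else 0.

(** Both prices are included even when [l] is 0 or 1 and one of them may have probability 0. *)
Let on_path : set (R * unit) := [set q | q.1 = Ev \/ q.1 = plow].

Let uninformed (v : R) : X := ((tt, tt), v).

Let measurable_uninformed : measurable_fun setT uninformed.
Proof. by apply: measurable_fun_pair => //; exact: measurable_cst. Qed.

Let uninformedM : {mfun R >-> X} :=
  HB.pack uninformed (isMeasurableFun.Build _ _ _ _ _ measurable_uninformed).

Let P : probability X R := distribution mu uninformedM.

Let marginal (A : set R) : measurable A -> P (setT `*` A) = mu A.
Proof.
move=> _; rewrite /P /distribution /pushforward; congr (mu _).
by apply/seteqP; split => v //= -[].
Qed.

Let measurable_on_path : measurable on_path.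
Proof.
rewrite (_ : on_path = ([set Ev] `*` setT) `|` ([set plow] `*` setT)).
  by apply: measurableU; apply: measurableX.
by apply/seteqP; split => q /=; [case=> qE|case=> -[qE _]]; by [left|right].
Qed.

Let malpha : measurable_fun setT alpha.
Proof.
have meq (r : R) : measurable_fun setT (fun q : R * unit => q.1 == r).
  apply: (measurable_fun_bool true); rewrite setTI.
  rewrite (_ : _ @^-1` _ = [set r] `*` setT); first exact: measurableX.
  by apply/seteqP; split => q /=; [move/eqP|case=> -> _; rewrite eqxx].
apply: measurable_fun_ifT => //; apply: measurable_fun_ifT => //.
by apply: measurable_fun_ifT => //; exact: measurable_fun_ler.
Qed.

Let nu := prior_or_dirac mu vlo measurable_on_path.
Let mix := cst_kernel unit (two_point_law l Ev plow).

Let N : set X := setT `*` ~` V.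

Let mN : measurable N.
Proof. by apply: measurableX => //; exact: measurableC. Qed.

Let N0 : P N = 0%E.
Proof. by rewrite marginal//; exact: measurableC. Qed.

Let notN (x : X) : ~ N x -> V x.2.
Proof. by move=> Nx; apply: contrapT => Vx; apply: Nx. Qed.

Let muV : mu V = 1%E.
Proof.
rewrite -(setCK V) probability_setC; last exact: measurableC.
by rewrite V0 sube0.
Qed.

Let mean_prior : (\int[mu]_v v%:E = Ev%:E)%E.
Proof.
rewrite -(mean_valueE mu mV Vb).
apply: (eq_integral_off_null (measurableC mV) V0) => v /contrapT Vv.
by rewrite patchE mem_set.
Qed.

Let mean_dirac : (\int[\d_vlo]_v v%:E = vlo%:E :> \bar R)%E.
Proof.
by rewrite integral_dirac ?diracT ?mul1e//; exact/measurable_EFinP.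
Qed.

Let dirac_vlo : \d_vlo V = 1%E :> \bar R.
Proof. by rewrite diracE mem_set. Qed.

Let alpha_low : alpha (plow, tt) = 1.
Proof.
rewrite /alpha /= eqxx; case: eqP => // lowE.
have sE : Ev - Ec = s by rewrite -lowE /plow addrK.
by rewrite -sE divff// gt_eqF.
Qed.

Let alpha_high : alpha (Ev, tt) = s / (Ev - Ec).
Proof. by rewrite /alpha /= eqxx. Qed.

Let alpha01 q : 0 <= alpha q <= 1.
Proof.
rewrite /alpha; case: ifP => _.
  by rewrite divr_ge0 ?(ltW S0)//= ler_pdivrMr// mul1r.
by case: ifP => _; [|case: ifP => _]; rewrite lexx ler01.
Qed.

(** No price beats [s]: both [Ev] and [plow] earn exactly [s], an accepted price up to [vlo] earns
    at most [vlo - Ec], and a rejected one earns 0. *)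
Let margin_le p : (p - Ec) * alpha (p, tt) <= s.
Proof.
rewrite /alpha /=; case: eqP => [->|_].
  by rewrite mulrC mulrVK// unitfE gt_eqF.
case: eqP => [->|_]; first by rewrite mulr1 /plow; lra.
by case: ifP => [plo|_]; rewrite ?mulr1 ?mulr0//; move: slb; lra.
Qed.

Let integral_value : (\int[P]_x ((id \_ V) x.2)%:E = Ev%:E)%E.
Proof.
rewrite (integral_marginal marginal (measurable_value mV) (value_bound Vb)).
exact: (mean_valueE mu mV Vb).
Qed.

Let integral_cost : (\int[P]_x ((c \_ V) x.2)%:E = Ec%:E)%E.
Proof. by rewrite (integral_marginal marginal mc cK) (mean_costE mu mc cK). Qed.

Let integrable_value2 : P.-integrable setT (EFin \o (fun x => (id \_ V) x.2)).
Proof.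
apply: (@bounded_integrable _ _ _ _ (fun x : X => (id \_ V) x.2)
  (`|vlo| + `|vhi|) (probability_lty P)).
  by apply: measurableT_comp => //; exact: measurable_value.
by move=> x; exact: (value_bound Vb).
Qed.

Let integrable_cost2 : P.-integrable setT (EFin \o (fun x => (c \_ V) x.2)).
Proof.
apply: (@bounded_integrable _ _ _ _ (fun x : X => (c \_ V) x.2) K
  (probability_lty P)).
  exact: measurableT_comp.
by move=> x; exact: cK.
Qed.

Let P1 : P setT = 1%E. Proof. exact: probability_setT. Qed.

Let malphap : measurable_fun setT (fun p : R => alpha (p, tt)).
Proof. by apply: measurableT_comp => //; exact: measurable_fun_pair. Qed.

Let buyerE : buyer_payoff P mix alpha = ((1 - l) * (Ev - Ec - s))%:E.
Proof.
(* For a fixed value, the average over the two prices is affine in the value: the slope is the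
   probability of trade, the constant is minus the expected payment. *)
rewrite /buyer_payoff (eq_integral_off_null mN N0 (g := fun x =>
  ((l * (s / (Ev - Ec)) + (1 - l)) * (id \_ V) x.2 +
   - (l * (s / (Ev - Ec)) * Ev + (1 - l) * plow))%:E)); last first.
  move=> -[[[] []] v] /notN /= Vv; rewrite integral_two_point//; last first.
    by apply: measurable_funM => //; exact: measurable_funB.
  by rewrite alpha_low alpha_high patchE mem_set//; congr EFin; ring.
rewrite integral_affine// integral_value -EFinM -EFinD /plow; congr EFin.
by ring.
Qed.

Let sellerE : seller_payoff c P mix alpha = s%:E.
Proof.
rewrite /seller_payoff (eq_integral_off_null mN N0 (g := fun x =>
  (- (l * (s / (Ev - Ec)) + (1 - l)) * (c \_ V) x.2 +
   (l * (s / (Ev - Ec)) * Ev + (1 - l) * plow))%:E)); last first.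
  move=> -[[[] []] v] /notN /= Vv; rewrite integral_two_point//; last first.
    by apply: measurable_funM => //; exact: measurable_funB.
  by rewrite alpha_low alpha_high patchE mem_set//; congr EFin; ring.
rewrite integral_affine// integral_cost -EFinM -EFinD /plow; congr EFin.
by field; rewrite gt_eqF.
Qed.

(** The deviating price need not have a mean, so [margin_le] is applied first: (p - c v) alpha is at
    most (Ec - c v) alpha + s. The price then enters only through the acceptance probability [b],
    and the cost terms cancel on averaging over v. *)
Let seller_optimal (sigma : R.-pker unit ~> R) :
  (seller_payoff c P sigma alpha <= s%:E)%E.
Proof.
pose m := sigma tt.
have m1 : m setT = 1%E by exact: prob_kernel.
have inta : m.-integrable setT (EFin \o (fun p => alpha (p, tt))).
  apply: (@bounded_integrable _ _ _ _ _ 1) => //.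
    by rewrite [ltLHS]m1 ltry.
  by move=> p; have /andP[a0 a1] := alpha01 (p, tt); rewrite ger0_norm.
have [b bE] : exists b, (\int[m]_p (alpha (p, tt))%:E = b%:E)%E.
  exists (fine (\int[m]_p (alpha (p, tt))%:E)%E).
  by rewrite fineK// integrable_fin_num.
apply: (@le_trans _ _ (\int[P]_x (- b * (c \_ V) x.2 + (Ec * b + s))%:E)%E).
  apply: (le_integral_off_null mN N0) => -[[[] []] v] /notN /= Vv.
  rewrite patchE mem_set// (_ : (_ + _)%:E =
    (\int[m]_p ((Ec - c v) * alpha (p, tt) + s)%:E)%E).
    by apply: le_integralT => p; rewrite lee_fin; have := margin_le p; lra.
  by rewrite integral_affine// bE -EFinM -EFinD; congr EFin; ring.
rewrite integral_affine// integral_cost -EFinM -EFinD lee_fin; lra.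
Qed.

(** The price is independent of the value, so redrawing the value from the prior does not change the
    joint law. Both sides equal the mixture of the prior probabilities [I] of the sections of [D] at
    the two prices. *)
Let consistent (D : set (R * X)) : measurable D ->
  (\int[P]_x \int[mix x.1.1]_p \int[nu (p, x.1.2)]_w
      (\1_D (p, (x.1, w)) : R)%:E)%E
  = (\int[P]_x \int[mix x.1.1]_p (\1_D (p, x) : R)%:E)%E.
Proof.
move=> mD; have m1D : measurable_fun setT (\1_D : R * X -> R).
  exact: measurable_indic.
have mval p : measurable_fun setT (fun v : R => \1_D (p, (tt, tt, v)) : R).
  apply: measurableT_comp => //; apply: measurable_fun_pair => //.
have mprice x : measurable_fun setT (fun p : R => \1_D (p, x) : R).
  by apply: measurableT_comp => //; exact: measurable_fun_pair.
have [l0 l1] := andP l01.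
pose I p := (\int[mu]_v (\1_D (p, (tt, tt, v)) : R)%:E)%E.
transitivity (l%:E * I Ev + (1 - l)%:E * I plow)%E.
  transitivity (\int[P]_x (l%:E * I Ev + (1 - l)%:E * I plow))%E; last first.
    rewrite integral_cst//; apply: etrans (mule1 _).
    by congr (_ * _)%E; exact: P1.
  apply: eq_integral => -[[[] []] v] _ /=.
  rewrite ge0_integral_two_point//; last 2 first.
  - have mtt : measurable_fun setT (fun p : R => (p, tt)).
      exact: measurable_fun_pair.
    apply: (@measurable_integral_pker _ _ _ _ _ (pullback_kernel nu mtt)
      (fun z => \1_D (z.1, (tt, tt, z.2)))).
    apply: (measurableT_comp m1D); apply: measurable_fun_pair => //.
    exact: measurable_fun_pair.
  - by move=> p; apply: integral_ge0 => w _; rewrite lee_fin.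
  (* Both prices are in [on_path], where [nu] is the prior. *)
  by rewrite /nu /prior_or_dirac !mem_set//=; [right|left].
(* On the side of the actual values, averaging over prices first leaves a function of the value
   alone, to which the marginal applies. *)
transitivity (\int[P]_x ((l * \1_D (Ev, (tt, tt, x.2)) +
    (1 - l) * \1_D (plow, (tt, tt, x.2)))%:E))%E; last first.
  apply: eq_integral => -[[[] []] v] _ /=.
  by rewrite integral_two_point.
pose g v : R := l * \1_D (Ev, (tt, tt, v)) + (1 - l) * \1_D (plow, (tt, tt, v)).
have mg : measurable_fun setT g.
  by apply: measurable_funD; apply: measurable_funM.
have ind01 z : 0 <= (\1_D z : R) <= 1.
  by rewrite indicE; case: (_ \in _); rewrite /= ?lexx ?ler01.
have gM v : `|g v| <= 1.
  rewrite /g; have := ind01 (Ev, (tt, tt, v)); have := ind01 (plow, (tt, tt, v)).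
  move=> /andP[? ?] /andP[? ?]; rewrite ger0_norm; nra.
rewrite (integral_marginal marginal mg gM) /g.
under eq_integral do rewrite EFinD !EFinM.
rewrite ge0_integralD//=.
- rewrite !ge0_integralZl_EFin ?subr_ge0//.
  - exact/measurable_EFinP.
  - exact/measurable_EFinP.
- by move=> v _; rewrite -EFinM lee_fin mulr_ge0.
- by apply/measurable_EFinP; apply: measurable_funM.
- by move=> v _; rewrite -EFinM lee_fin mulr_ge0 ?subr_ge0.
- by apply/measurable_EFinP; apply: measurable_funM.
Qed.

Lemma two_price_equilibrium :
  all_eq_payoffs V c mu ((1 - l) * (Ev - Ec - s), s).
Proof.
exists _, _, unit, unit, P; split.
  by split => //; exact: polish_borel_unit.
exists mix, alpha, nu; split; last by split; [exact: buyerE | exact: sellerE].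
split.
- split => // q; rewrite /= /prior_or_dirac; case: ifPn => _.
    exact: muV.
  exact: dirac_vlo.
(* Where acceptance is forced: never at [Ev], by indifference; at [plow], [alpha] is 1 (if it
   differs from [Ev]); off path, only below [vlo]. *)
- move=> p []; rewrite /= /prior_or_dirac; case: ifPn.
    rewrite inE mean_prior lte_fin /alpha => -[/= ->|/= ->].
      by rewrite ltxx.
    by rewrite eqxx; case: eqP => // ->; rewrite ltxx.
  rewrite notin_setE mean_dirac lte_fin /alpha /=.
  move=> /not_orP[/eqP/negPf-> /eqP/negPf->].
  by move=> /ltW ->.
(* Where rejection is forced: never on path, since [sub] gives [plow <= Ev]; off path, above
   [vlo]. *)
- move=> p []; rewrite /= /prior_or_dirac; case: ifPn.
    rewrite inE mean_prior lte_fin /alpha => -[/= ->|/= ->].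
      by rewrite ltxx.
    by rewrite ltNge -lerBrDr sub.
  rewrite notin_setE mean_dirac lte_fin /alpha /=.
  move=> /not_orP[/eqP/negPf-> /eqP/negPf->].
  by rewrite ltNge => /negPf ->.
- by move=> sigma; rewrite sellerE; exact: seller_optimal.
- exact: consistent.
Qed.

End Sufficiency.

(** * Equality of the two payoff sets *)

Theorem theorem1 (R : realType) (mu : probability R R) (V : set R) (c : R -> R)
  (vlo vhi : R) :
  V = msupport mu ->
  compact V ->
  V vlo -> V vhi -> (forall v, V v -> vlo <= v <= vhi) -> vlo < vhi ->
  {within V, continuous c} ->
  (forall v, V v -> 0 <= v - c v) ->
  (0 < \int[mu]_(v in V) (v - c v)%:E)%E ->
  all_eq_payoffs V c mu =
  [set pi : R * R | 0 <= pi.1 /\ seller_lb V c mu vlo <= pi.2 /\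
                    pi.1 + pi.2 <= surplus V c mu].
Proof.
move=> VE cptV Vlo Vhi Vb vlohi cc cv S_gt0.
have mV : measurable V by exact: compact_measurable.
have V0 : mu (~` V) = 0%E.
  rewrite VE; apply: msupport_measure0; rewrite -VE.
  exact: compact_closed.
have mc : measurable_fun setT (c \_ V).
  apply/(measurable_restrictT _ mV).
  exact: subspace_continuous_measurable_fun.
have [K cK] : exists K, forall v, `|(c \_ V) v| <= K.
  (* Boundedness provides a bound by every number strictly above [M], hence [M + 1]. It is
     nonnegative because [V] contains [vlo], so it also covers the value 0 outside [V]. *)
  have [M [_ /(_ (M + 1)) bM]] := compact_bounded (continuous_compact cc cptV).
  have {bM} bM v : V v -> `|c v| <= M + 1.
    by move=> Vv; apply: bM; [rewrite ltrDl | exists v].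
  exists (M + 1) => v; rewrite patchE; case: ifPn => [|_].
    by rewrite inE; exact: bM.
  by rewrite normr0; exact: le_trans (bM _ Vlo).
pose Ev := mean_value mu V; pose Ec := mean_cost mu V c.
have SE : surplus V c mu = Ev - Ec by exact: (surplusE mu mV Vb mc cK).
have {}S_gt0 : 0 < Ev - Ec.
  by rewrite -lte_fin -(integral_surplus mu mV Vb mc cK).
apply/seteqP; split => [[pb ps]|[pb ps]] /=.
- move=> [dS [dB [TS [TB [P [[_ _ marginal] +]]]]]].
  move=> [sigma [alpha [nu [eqm [/= pbE psE]]]]]; split.
    rewrite -lee_fin -pbE.
    exact: (buyer_payoff_ge0 mV V0 Vb vlohi marginal eqm).
  split; first exact: (seller_payoff_ge_lb mV V0 Vb mc cK marginal eqm).
  rewrite SE; exact: (total_payoff_le mV V0 Vb mc cK cv marginal eqm).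
- rewrite SE /seller_lb -/Ec ge_max => -[pb0 [/andP[pslb ps0] sub]].
  have [S_eq|S_neq] := eqVneq (Ev - Ec - ps) 0.
    have -> : pb = (1 - 0) * (Ev - Ec - ps).
      by apply/eqP; rewrite S_eq mulr0 eq_le pb0 andbT -S_eq lerBrDr.
    apply: (two_price_equilibrium mV V0 Vlo Vb mc cK) => //; last first.
      by rewrite lexx ler01.
    by rewrite -subr_ge0 S_eq.
  have Dgt0 : 0 < Ev - Ec - ps.
    by rewrite lt_def S_neq subr_ge0 (le_trans _ sub)// lerDr.
  (* The solution of (1 - l) (Ev - Ec - ps) = pb; it lies in [0, 1] because [pb] is between 0 and Ev
     - Ec - ps. *)
  pose l := 1 - pb / (Ev - Ec - ps).
  have -> : pb = (1 - l) * (Ev - Ec - ps) by rewrite /l; field.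
  apply: (two_price_equilibrium mV V0 Vlo Vb mc cK) => //.
    by rewrite -subr_ge0 ltW.
  rewrite /l subr_ge0 gerBl divr_ge0 ?(ltW Dgt0)// andbT.
  by rewrite ler_pdivrMr// mul1r lerBrDr.
Qed.
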